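(* Consider either the Hedge setting or the OCO setting described in the context, with the learner satisfying the second-order guarantee (G) with positive deterministic numbers $K_T$. Let $\epsilon(\eta)$ be the maximal normalized cumulant generating function of the excess loss family. Then for every $T\ge1$ and every $\gamma>0$, with $c=\frac{1}{1+\sqrt{1+4\gamma^2}}$, \[ R_T^{f^*}\;\trianglelefteq_\gamma\;\frac{K_T}{c\gamma}+T\,\epsilon(2\gamma)\,(1+c\gamma^2)+2K_T, \] i.e. $\mathbb E\Big[\exp\Big(\gamma\big(R_T^{f^*}-\tfrac{K_T}{c\gamma}-T\epsilon(2\gamma)(1+c\gamma^2)-2K_T\big)\Big)\Big]\le 1$. Here $R_T^{f^*}=R_T^{k^*}$ (Hedge) or $R_T^{u^*}$ (OCO).
   Context: Hedge setting: the experts are indexed by $k\in\mathbb N=\{1,2,\dots\}$. In each round $t=1,2,\dots$ the learner plays a probability mass function $w_t=(w_t^1,w_t^2,\dots)$ on $\mathbb N$; then the losses $\ell_t=(\ell_t^1,\ell_t^2,\dots)$ with $\ell_t^k\in[0,1]$ are revealed and the learner incurs $\langle w_t,\ell_t\rangle=\sum_k w_t^k\ell_t^k$. The regret against expert $k$ is $R_T^k=\sum_{t=1}^T(\langle w_t,\ell_t\rangle-\ell_t^k)$ and $V_T^k=\sum_{t=1}^T(\langle w_t,\ell_t\rangle-\ell_t^k)^2$. The losses are random with an arbitrary (not necessarily i.i.d.) joint distribution $\mathbb P$; $\mathcal G_{t-1}$ is the sigma-algebra generated by $\ell_1,\dots,\ell_{t-1}$, and $w_t$ is $\mathcal G_{t-1}$-measurable.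 It is assumed that there is a fixed expert $k^*$ with $\mathbb E[\ell_t^{k^*}\mid\mathcal G_{t-1}]=\inf_k\mathbb E[\ell_t^k\mid\mathcal G_{t-1}]$ almost surely for all $t$. The excess losses are $x_t^k=\ell_t^k-\ell_t^{k^*}$, indexed by $f=k\in\mathcal F=\mathbb N$. Guarantee (G): for every $T$ and every loss sequence, $R_T^{k^*}\le\sqrt{V_T^{k^*}K_T}+K_T$. OCO setting: the action set $\mathcal U\subseteq\mathbb R^d$ is compact and convex with Euclidean diameter at most $D$. In each round the learner plays $w_t\in\mathcal U$, then a convex loss function $\ell_t:\mathcal U\to\mathbb R$ is revealed, with (a fixed choice of) subgradients satisfying $\|\nabla\ell_t(w)\|_2\le G$ for all $w\in\mathcal U$, where $DG=1$. The regret is $R_T^u=\sum_{t=1}^T(\ell_t(w_t)-\ell_t(u))$, $\tilde R_T^u=\sum_{t=1}^T\langle w_t-u,\nabla\ell_t(w_t)\rangle$, and $V_T^u=\sum_{t=1}^T\langle w_t-u,\nabla\ell_t(w_t)\rangle^2$. The loss functions are random with arbitrary joint distribution $\mathbb P$; $\mathcal G_{t-1}$ is the sigma-algebra generated by $\ell_1,\dots,\ell_{t-1}$, and $w_t$ is $\mathcal G_{t-1}$-measurable. There is a fixed $u^*\in\mathcal U$ attaining $\min_{u\in\mathcal U}\mathbb E[\ell_t(u)\mid\mathcal G_{t-1}]$ for every $t$ almost surely. The excess losses are $x_t^u=\langle u-u^*,\nabla\ell_t(u)\rangle$, indexed by $f=u\in\mathcal F=\mathcal U$. Guarantee (G): for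 every $T$ and every sequence of loss functions, $\tilde R_T^{u^*}\le\sqrt{V_T^{u^*}K_T}+K_T$. Maximal normalized cumulant generating function: for $\eta>0$, $\epsilon(\eta)$ is the smallest number such that $\frac1\eta\ln\mathbb E[e^{-\eta x_t^f}\mid\mathcal G_{t-1}]\le\epsilon(\eta)$ almost surely for all $f\in\mathcal F$ and all $t$. Exponential stochastic inequality: for random variables $X,Y$ and $\eta\ge0$, $X\trianglelefteq_\eta Y$ means $\mathbb E[e^{\eta(X-Y)}]\le 1$. *)

(* Defs.v *)
From HB Require Import structures.
From mathcomp Require Import all_boot all_order all_algebra.
From mathcomp Require Import all_classical all_reals all_analysis.
Set Implicit Arguments. Unset Strict Implicit. Unset Printing Implicit Defensive.
Import Order.TTheory GRing.Theory Num.Theory.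
Import numFieldNormedType.Exports.
Local Open Scope classical_set_scope.
Local Open Scope ring_scope.

Section S.
Variable R : realType.

Definition sigma_gen (T : Type) (S : set (T -> R)) : set (set T) :=
  <<s [set A | exists2 X, S X & exists2 B : set R, measurable B & A = X @^-1` B] >>.

Definition G_meas (T : Type) (G : set (set T)) (Y : T -> R) : Prop :=
  forall B : set R, measurable B -> G (Y @^-1` B).

Definition cond_exp_version d (T : measurableType d) (P : probability T R)
  (G : set (set T)) (X Y : T -> R) : Prop :=
  [/\ G_meas G Y, P.-integrable setT (EFin \o X), P.-integrable setT (EFin \o Y) &
      forall A, G A -> (\int[P]_(w in A) (Y w)%:E = \int[P]_(w in A) (X w)%:E)%E].

Definition esi d (T : measurableType d) (P : probability T R) (eta : R)
  (X : T -> R) (Y : R) : Prop :=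
  (\int[P]_w (expR (eta * (X w - Y)))%:E <= 1)%E.
End S.

Section Settings.
Variable R : realType.
Local Open Scope ring_scope.

Definition is_pmf (w : nat -> R) : Prop :=
  (forall k, 0 <= w k) /\ (\sum_(k <oo) (w k)%:E = 1)%E.

Definition hedge_inner (w l : nat -> R) : R :=
  \big[+%R/0%R]_(0 <= k <oo) (w k * l k).

(** rounds are t = 1, ..., T ; W t = w_t, L t = l_t *)
Definition hedge_regret (W L : nat -> nat -> R) (T k : nat) : R :=
  \sum_(1 <= t < T.+1) (hedge_inner (W t) (L t) - L t k).

Definition hedge_var (W L : nat -> nat -> R) (T k : nat) : R :=
  \sum_(1 <= t < T.+1) (hedge_inner (W t) (L t) - L t k) ^+ 2.

(** G_{t-1} = sigma(l_s^k : 1 <= s <= t-1, k in nat) *)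
Definition hedge_past (T : Type) (l : nat -> T -> nat -> R) (t : nat) : set (set T) :=
  sigma_gen [set X | exists s k, (1 <= s < t)%N /\ X = (fun w => l s w k)].

Definition dotv (d : nat) (u v : 'rV[R]_d) : R := \sum_(i < d) u ord0 i * v ord0 i.
Definition norm2 (d : nat) (v : 'rV[R]_d) : R := Num.sqrt (dotv v v).

Definition convex_vset (d : nat) (U : set 'rV[R]_d) : Prop :=
  forall u v (a : R), U u -> U v -> 0 <= a <= 1 -> U (a *: u + (1 - a) *: v).

Definition oco_admissible (d : nat) (U : set 'rV[R]_d) (G : R)
  (F : 'rV[R]_d -> R) (Gr : 'rV[R]_d -> 'rV[R]_d) : Prop :=
  [/\ (forall u v (a : R), U u -> U v -> 0 <= a <= 1 ->
          F (a *: u + (1 - a) *: v) <= a * F u + (1 - a) * F v),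
      (forall w v, U w -> U v -> F w + dotv (v - w) (Gr w) <= F v) &
      (forall w, U w -> norm2 (Gr w) <= G)].

Definition oco_regret (d : nat) (W : nat -> 'rV[R]_d) (F : nat -> 'rV[R]_d -> R)
  (T : nat) (u : 'rV[R]_d) : R :=
  \sum_(1 <= t < T.+1) (F t (W t) - F t u).

Definition oco_lregret (d : nat) (W : nat -> 'rV[R]_d) (Gr : nat -> 'rV[R]_d -> 'rV[R]_d)
  (T : nat) (u : 'rV[R]_d) : R :=
  \sum_(1 <= t < T.+1) dotv (W t - u) (Gr t (W t)).

Definition oco_var (d : nat) (W : nat -> 'rV[R]_d) (Gr : nat -> 'rV[R]_d -> 'rV[R]_d)
  (T : nat) (u : 'rV[R]_d) : R :=
  \sum_(1 <= t < T.+1) (dotv (W t - u) (Gr t (W t))) ^+ 2.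

(** G_{t-1} = sigma(l_s(u), grad l_s(u) : 1 <= s <= t-1, u in U) *)
Definition oco_past (T : Type) (d : nat) (U : set 'rV[R]_d)
  (f : nat -> T -> 'rV[R]_d -> R) (g : nat -> T -> 'rV[R]_d -> 'rV[R]_d)
  (t : nat) : set (set T) :=
  sigma_gen [set X | exists s u, [/\ (1 <= s < t)%N, U u &
     X = (fun w => f s w u) \/ exists i : 'I_d, X = (fun w => g s w u ord0 i)]].

End Settings.

(* Main.v *)
(** Write [r_t] for the instantaneous (linearised) regret and [a = c gamma].
    By (G) and AM-GM, [R <= K / a + 2 K + sum_t (a r_t^2 - r_t)], so it suffices
    to bound the expectation of [prod_t phi r_t], where
    [phi x = exp (gamma (a x^2 - x))], by
    [exp (T gamma epsilon (1 + c gamma^2))].  In the variable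
    [u = exp (- 2 gamma x)] the function [phi] is concave on [|x| <= 1] for
    exactly this value of [c]; its tangent at [u = exp (2 gamma epsilon)] turns
    the conditional bound on [u] into one on [phi], provided that
    [epsilon <= min gamma 1], and otherwise the claim holds pointwise.

    For Hedge, [phi] is convex, so [phi r_t] is at most the [w_t]-mixture of the
    [phi x_t^k].  For OCO, joint measurability of the subgradients is not
    available; instead [w_t] is replaced by a nearby point of a finite net,
    chosen next to the segment from [u*] to [w_t], where monotonicity of
    subgradients controls the error. *)

Require Import Defs.
From HB Require Import structures.
From mathcomp Require Import all_boot all_order all_algebra.
From mathcomp Require Import all_classical all_reals all_analysis.
From mathcomp Require finmap.
From mathcomp Require Import measurable_realfun.
From mathcomp Require Import ring lra.
Import Order.TTheory GRing.Theory Num.Theory.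
Import numFieldNormedType.Exports.
Local Open Scope classical_set_scope.
Local Open Scope ring_scope.
Set Implicit Arguments.
Unset Strict Implicit.
Unset Printing Implicit Defensive.

(** * Calculus: a tangent majorant for the exponential of a quadratic *)

Lemma derive_le0_le {R : realType} (f df : R -> R) (a b : R) : a <= b ->
  (forall x : R, is_derive x 1 f (df x)) ->
  (forall x, a <= x <= b -> df x <= 0) -> f b <= f a.
Proof.
move=> ab fdf df0.
have cf : {within `[a, b], continuous f}.
  apply: continuous_subspaceT => x; apply: differentiable_continuous.
  by apply/derivable1_diffP; have [] := fdf x.
have [x] := MVT_segment ab (fun x _ => fdf x) cf.
rewrite in_itv/= => /df0 dfx0 fab.
by rewrite -subr_le0 fab mulr_le0_ge0// subr_ge0.
Qed.

Lemma derive_ge0_le {R : realType} (f df : R -> R) (a b : R) : a <= b ->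
  (forall x : R, is_derive x 1 f (df x)) ->
  (forall x, a <= x <= b -> 0 <= df x) -> f a <= f b.
Proof.
move=> ab fdf df0; rewrite -lerN2.
apply: (@derive_le0_le _ (- f) (- df)) => // x.
by move=> xab; rewrite oppr_le0 df0.
Qed.

Section exp_quadratic.
Variable R : realType.
Implicit Types (c g s x : R).

Let q c s := c * s ^+ 2 / 4 + s / 2.

(* The hypothesis on [c] says that [u |-> exp (q c (ln u))] is concave on
   [[exp (- 2 g), exp (2 g)]]; the bound is its tangent line at [exp s0]. *)
Lemma expR_quad_tangent c g s0 : 0 <= c -> 2 * c + 4 * c ^+ 2 * g ^+ 2 <= 1 ->
  c * g <= 1 / 2 -> 0 <= s0 <= 2 * g ->
  exists a b : R, [/\ 0 <= a, 0 <= b, a + b * expR s0 = expR (q c s0) &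
    forall s, - (2 * g) <= s <= 2 * g -> expR (q c s) <= a + b * expR s].
Proof.
move=> c0 cg cg2 /andP[s00 s0g].
(* [N] is the derivative of [expR (q c s)] with respect to [u = expR s], so concavity in [u] means
   that [N] decreases; [dN] is its derivative in [s]. *)
pose N s := expR (q c s - s) * ((1 + c * s) / 2).
pose dN s := expR (q c s - s) * ((c ^+ 2 * s ^+ 2 - 1 + 2 * c) / 4).
have qD s : is_derive s 1 (q c) ((1 + c * s) / 2).
  rewrite /q; apply: is_derive_eq.
  by rewrite /GRing.scale/=; field.
have ND s : is_derive s 1 N (dN s).
  rewrite /N; apply: is_derive_eq.
  by rewrite /dN /GRing.scale/= /q; field.
have sq_le s : - (2 * g) <= s <= 2 * g -> s ^+ 2 <= 4 * g ^+ 2.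
  move=> /andP[s1 s2]; have : 0 <= (2 * g - s) * (2 * g + s).
    by apply: mulr_ge0; lra.
  by lra.
have dN0 s : - (2 * g) <= s <= 2 * g -> dN s <= 0.
  move=> sg; rewrite /dN pmulr_rle0 ?expR_gt0//.
  have := ler_wpM2l (sqr_ge0 c) (sq_le _ sg); lra.
have N_nincr s s' : - (2 * g) <= s -> s <= s' -> s' <= 2 * g -> N s' <= N s.
  move=> s1 ss' s2; apply: (derive_le0_le ss' ND) => x /andP[sx xs'].
  by apply: dN0; rewrite (le_trans s1 sx) (le_trans xs' s2).
have NE s : N s * expR s = expR (q c s) * ((1 + c * s) / 2).
  by rewrite /N mulrAC -expRD subrK.
(* Up to a constant, [D] is the tangent at [s0] minus the function; its derivative passes from
   nonpositive to nonnegative at [s0], where [D] is therefore minimal. *)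
pose D s := N s0 * expR s - expR (q c s).
have DD s : is_derive s 1 D ((N s0 - N s) * expR s).
  rewrite /D; apply: is_derive_eq.
  by rewrite mulrBl NE /GRing.scale/=; ring.
exists (expR (q c s0) - N s0 * expR s0), (N s0); split.
(* The intercept is nonnegative since [N s0 * expR s0] is [expR (q c s0)] times [(1 + c * s0) / 2],
   a factor at most 1 by [c * s0 <= 2 * c * g <= 1]. *)
- rewrite NE -{1}[expR (q c s0)]mulr1 -mulrBr mulr_ge0 ?expR_ge0//.
  have := ler_wpM2l c0 s0g; lra.
- by rewrite /N mulr_ge0 ?expR_ge0// divr_ge0// addr_ge0// mulr_ge0.
- by rewrite subrK.
move=> s /andP[s1 s2].
suff : D s0 <= D s by rewrite /D; lra.
have [s0s|/ltW ss0] := leP s0 s.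
- apply: (derive_ge0_le s0s DD) => x /andP[s0x xs].
  rewrite mulr_ge0 ?expR_ge0// subr_ge0 N_nincr//; lra.
- apply: (derive_le0_le ss0 DD) => x /andP[sx xs0].
  rewrite mulr_le0_ge0 ?expR_ge0// subr_le0 N_nincr//; lra.
Qed.

(** The given [c] is the positive root of [4 g^2 c^2 + 2 c = 1], hence the largest value that the
    concavity condition allows; [c * g <= 1 / 2] comes from [2 * g <= S]. *)
Lemma sqrt_ratio_props g : 0 < g ->
  let c := 1 / (1 + Num.sqrt (1 + 4 * g ^+ 2)) in
  [/\ 0 < c, 2 * c + 4 * c ^+ 2 * g ^+ 2 = 1, c * g <= 1 / 2 & c <= 1 / 2].
Proof.
move=> g0 /=; set S := Num.sqrt _.
have g2 : 0 < g ^+ 2 by rewrite exprn_gt0.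
have SS : S ^+ 2 = 1 + 4 * g ^+ 2 by rewrite sqr_sqrtr//; lra.
have S1 : 1 <= S by rewrite -[1]sqrtr1 ler_wsqrtr//; lra.
have S2g : 2 * g <= S.
  rewrite -(@ler_pXn2r _ 2) ?nnegrE//; [|lra..].
  rewrite SS exprMn; lra.
have S0 : 0 < 1 + S by lra.
split.
- by rewrite divr_gt0.
- have -> : 4 * (1 / (1 + S)) ^+ 2 * g ^+ 2
      = (1 / (1 + S)) ^+ 2 * (S ^+ 2 - 1) by rewrite SS; ring.
  by field; lra.
- by rewrite mulrAC mul1r ler_pdivrMr//; lra.
- by rewrite ler_pdivrMr//; lra.
Qed.

(** Substitute [s = - 2 g x] in the tangent bound at [s0 = 2 g e]. The condition [e <= 1] keeps [s0]
    within [2 g], and [e <= g] absorbs the term [c g^2 e^2] into [c g^3 e]. *)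
Lemma expR_excess_majorant g (e : R) : 0 < g -> 0 <= e -> e <= g -> e <= 1 ->
  let c := 1 / (1 + Num.sqrt (1 + 4 * g ^+ 2)) in
  exists a b : R, [/\ 0 <= a, 0 <= b,
    a + b * expR (2 * g * e) <= expR (g * e * (1 + c * g ^+ 2)) &
    forall x, -1 <= x <= 1 ->
      expR (g * (c * g * x ^+ 2 - x)) <= a + b * expR (- (2 * g) * x)].
Proof.
move=> g0 e0 eg e1 c.
have [c0 cg cg2 _] := sqrt_ratio_props g0.
have [||a] := @expR_quad_tangent c g (2 * g * e) (ltW c0) _ cg2.
- by rewrite cg.
- by rewrite !mulr_ge0 ?(ltW g0)//= ler_piMr//; lra.
move=> [b [a0 b0 abE abq]]; exists a, b; split => //.
- rewrite abE ler_expR /q.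
  have -> : g * e * (1 + c * g ^+ 2) =
    c * (2 * g * e) ^+ 2 / 4 + 2 * g * e / 2 + c * g ^+ 2 * e * (g - e) by field.
  rewrite lerDl mulr_ge0 ?subr_ge0// mulr_ge0// mulr_ge0 ?sqr_ge0//.
  exact: ltW.
- move=> x /andP[x1 x2].
  have -> : g * (c * g * x ^+ 2 - x) = q c (- (2 * g) * x) by rewrite /q; field.
  apply: abq; rewrite mulNr lerNl opprK ler_piMr//=; last lra.
  by rewrite lerNl; have := ler_wpM2l (ltW g0) x1; lra.
Qed.

End exp_quadratic.

(** * Integration and conditional expectation over a sub-sigma-algebra *)

Lemma ge0_le_integralT d (T : measurableType d) (R : realType)
    (mu : {measure set T -> \bar R}) (f1 f2 : T -> \bar R) :
  (forall x, 0 <= f1 x)%E -> (forall x, f1 x <= f2 x)%E ->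
  (\int[mu]_x f1 x <= \int[mu]_x f2 x)%E.
Proof.
move=> f10 f12; have f20 x : (0 <= f2 x)%E by exact: le_trans (f12 x).
(* The integral of a nonnegative function is a supremum over simple functions below it, so the
   comparison holds without measurability; the exponential of the OCO regret is integrated in this
   way. *)
rewrite !ge0_integralTE//; apply: ge_ereal_sup => _ [h hf1 <-].
by apply: ereal_sup_ubound; exists h => // x; exact: le_trans (hf1 x) (f12 x).
Qed.

Section sub_sigma_algebra.
Context d (T : measurableType d) (R : realType) (P : probability T R).
Variable gens : set (set T).
Hypothesis gensT : <<s gens >> `<=` measurable.
Local Notation G := (g_sigma_algebraType gens).
Import HBNNSimple.

Lemma measurable_fun_sub d' (U : measurableType d') (f : T -> U) :
  measurable_fun [set: G] f -> measurable_fun [set: T] f.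
Proof.
move=> mf _ B mB; apply: gensT.
by have := mf measurableT B mB.
Qed.

(** The hypothesis on [Z] is the conditional bound E[Z | G] <= B in integrated form. It extends from
    level sets to simple functions measurable for the sub-sigma-algebra, then to [H] by monotone
    convergence. *)
Lemma integral_mul_le_sub (Z : T -> R) (H : T -> \bar R) (B : R) : 0 <= B ->
  measurable_fun setT Z -> (forall x, 0 <= Z x) ->
  (forall A, <<s gens >> A -> \int[P]_(x in A) (Z x)%:E <= B%:E * P A)%E ->
  measurable_fun [set: G] H -> (forall x, 0 <= H x)%E ->
  (\int[P]_x (H x * (Z x)%:E) <= B%:E * \int[P]_x H x)%E.
Proof.
move=> B0 mZ Z0 ZB mH H0.
have mZE : measurable_fun setT (EFin \o Z) by exact/measurable_EFinP.
have ZE0 x : (0 <= (Z x)%:E)%E by rewrite lee_fin.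
pose h := nnsfun_approx (@measurableT _ G) mH.
have mhG n : measurable_fun [set: G] (h n) by exact: measurable_funP.
have mh n : measurable_fun [set: T] (h n) by exact: measurable_fun_sub.
have h0 n x : (0 <= (h n x)%:E)%E by rewrite lee_fin.
have hH x : ((h n x)%:E @[n --> \oo] --> H x)%E.
  exact: (@cvg_nnsfun_approx _ _ _ _ measurableT _ mH (fun x _ => H0 x)).
have h_nd x a b : (a <= b)%N -> ((h a x)%:E <= (h b x)%:E)%E.
  by move=> ab; rewrite lee_fin; exact/lefP/nd_nnsfun_approx.
have hle n x : ((h n x)%:E <= H x)%E.
  rewrite -(cvg_lim _ (hH x))//; apply: lime_ge.
    by apply/cvg_ex; exists (H x); exact: hH.
  by exists n => // m; exact: h_nd.
have mph n r : <<s gens >> (h n @^-1` [set r]).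
  by have := mhG n measurableT _ (measurable_set1 r); rewrite setTI.
have -> : (\int[P]_x (H x * (Z x)%:E) =
    limn (fun n => \int[P]_x ((h n x)%:E * (Z x)%:E)))%E.
  rewrite -monotone_convergence//; last 3 first.
  - by move=> n; apply: emeasurable_funM => //; exact/measurable_EFinP.
  - by move=> n x _; rewrite mule_ge0.
  - by move=> x _ a b ab; rewrite lee_wpmul2r// h_nd.
  apply: eq_integral => x _.
  by apply/esym/cvg_lim => //; apply: cvgeZr => //; exact: hH.
apply: lime_le.
  apply: ereal_nondecreasing_is_cvgn => a b ab.
  apply: ge0_le_integralT => x; first by rewrite mule_ge0.
  by rewrite lee_wpmul2r// h_nd.
apply: nearW => n.
apply: (@le_trans _ _ (B%:E * \int[P]_x (h n x)%:E)%E); last first.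
  by rewrite lee_wpmul2l// ge0_le_integralT.
have mind r : measurable_fun [set: T] (fun x => (r * \1_(h n @^-1` [set r]) x)%:E).
  apply/measurable_EFinP; apply: measurable_funM => //.
  by apply: measurable_indic; apply: gensT; exact: mph.
have ind0 r x : (0 <= (r * \1_(h n @^-1` [set r]) x)%:E)%E.
  exact: nnfun_muleindic_ge0.
under eq_integral do rewrite fimfunE -fsumEFin// ge0_mule_fsuml//.
rewrite ge0_integral_fsum//; last 2 first.
  - by move=> r; apply: emeasurable_funM.
  - by move=> r x _; rewrite mule_ge0.
under [in leRHS]eq_integral do rewrite fimfunE -fsumEFin//.
rewrite ge0_integral_fsum// ge0_mule_fsumr//; last first.
  by move=> r; exact: integral_ge0.
apply: lee_fsum => // r [x _ <-{r}].
set r := h n x; set A := _ @^-1` _.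
have mA : measurable (A : set T) by apply: gensT; exact: mph.
have r0 : (0 <= r%:E)%E by rewrite lee_fin.
under eq_integral do rewrite EFinM -muleA.
rewrite ge0_integralZl//; last 2 first.
  - by apply: emeasurable_funM => //; apply/measurable_EFinP; exact: measurable_indic.
  - by move=> y _; rewrite mule_ge0// lee_fin.
under [in leRHS]eq_integral do rewrite EFinM.
rewrite ge0_integralZl//; last by apply/measurable_EFinP; exact: measurable_indic.
rewrite integral_indic// setIT muleCA lee_wpmul2l//.
apply: le_trans (ZB _ (mph n r)).
rewrite -/A (integral_mkcond (A : set T)).
apply: ge0_le_integralT => y; first by rewrite mule_ge0// lee_fin.
by rewrite epatch_indic muleC.
Qed.

End sub_sigma_algebra.

Section conditional_expectation.
Context d (T : measurableType d) (R : realType) (P : probability T R).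
Variable gens : set (set T).
Hypothesis gensT : <<s gens >> `<=` measurable.
Local Notation G := (g_sigma_algebraType gens).

(** Radon-Nikodym for the charge [A |-> \int_A X] restricted to the sub-sigma-algebra. The cumulant
    bound speaks of all versions and is informative only once one exists. *)
Lemma cond_exp_version_exists (X : T -> R) : P.-integrable setT (EFin \o X) ->
  exists Y, cond_exp_version P <<s gens >> X Y.
Proof.
move=> intX.
have mid : measurable_fun [set: T] (id : T -> G) by move=> _ B mB; rewrite setTI; exact: gensT.
pose idG : {mfun T >-> G} := HB.pack (id : T -> G) (isMeasurableFun.Build _ _ T G id mid).
(* The restriction of [P] to the smaller sigma-algebra is its image under the identity. *)
pose mu := distribution P idG.
pose nu0 := induced_charge intX.
pose nuf (A : set G) : \bar R := nu0 A.
have nuf0 : nuf set0 = 0%E by exact: charge0.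
have nuf_fin A : measurable A -> nuf A \is a fin_num.
  by move=> /gensT mA; exact: fin_num_measure.
have nuf_sigma : semi_sigma_additive nuf.
  move=> F mF tF mUF; apply: (@charge_semi_sigma_additive _ _ _ nu0) => //.
  - by move=> i; apply: gensT; exact: mF.
  - by apply: gensT; exact: mUF.
pose nu : {charge set G -> \bar R} :=
  HB.pack nuf (isCharge.Build _ G R nuf nuf0 nuf_fin nuf_sigma).
have numu : nu `<< mu.
  apply/null_content_dominatesP => A mA muA.
  by apply: null_set_integral => //; [exact: gensT|
    apply: measurable_funTS; exact: measurable_int intX].
have fin_f x := Radon_Nikodym_fin_num x numu.
have /integrableP[mf ltf] := Radon_Nikodym_integrable numu.
pose f := Radon_Nikodym nu mu.
have mfT : measurable_fun [set: T] f by exact: measurable_fun_sub mf.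
have intf : P.-integrable [set: T] f.
  apply/integrableP; split => //; apply: le_lt_trans ltf.
  rewrite ge0_integral_pushforward//=.
  by apply: measurableT_comp.
exists (fine \o f); split => //.
- move=> B mB.
  have mff : measurable_fun [set: G] (fine \o f) by exact: measurableT_comp.
  by have := mff measurableT B mB; rewrite setTI.
- apply: eq_integrable intf => // x _.
  by rewrite /= fineK.
- move=> A GA; have := Radon_Nikodym_integral numu GA.
  rewrite /nu/= /nuf /nu0 /induced_charge => ->.
  rewrite integral_pushforward//=.
  + by apply: eq_integral => x _; rewrite /= fineK.
  + by apply: integrableS intf => //; exact: gensT.
Qed.
End conditional_expectation.

Lemma bounded_integrable d (T : measurableType d) (R : realType)
    (P : probability T R) (X : T -> R) (C : R) :
  measurable_fun setT X -> (forall x, 0 <= X x <= C) ->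
  P.-integrable setT (EFin \o X).
Proof.
move=> mX XC; apply: (@le_integrable _ _ _ _ _ measurableT _ (EFin \o cst C)).
- exact/measurable_EFinP.
- move=> x _; have /andP[X0 XC'] := XC x.
  by rewrite /= lee_fin !ger0_norm//; exact: le_trans XC'.
- exact: finite_measure_integrable_cst.
Qed.

(** Boundedness of [X] provides a version; its bound [C] is integrated over [A] minus an exceptional
    null set. *)
Lemma cond_exp_le_integral d (T : measurableType d) (R : realType)
    (P : probability T R) (gens : set (set T)) (X : T -> R) (M C : R) :
  <<s gens >> `<=` measurable ->
  measurable_fun setT X -> (forall x, 0 <= X x <= M) -> 0 <= C ->
  (forall Y, cond_exp_version P <<s gens >> X Y -> {ae P, forall w, Y w <= C}) ->
  forall A, <<s gens >> A -> (\int[P]_(x in A) (X x)%:E <= C%:E * P A)%E.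
Proof.
move=> gensT mX XM C0 YC A GA.
have mA := gensT _ GA.
have [Y XY] := cond_exp_version_exists gensT (bounded_integrable P mX XM).
have [_ _ intY <-//] := XY.
have [N [mN PN NY]] := YC _ XY.
rewrite (negligible_integral mN)//; last exact: integrableS intY.
have mAN : measurable (A `\` N) by exact: measurableD.
apply: (@le_trans _ _ (\int[P]_(x in A `\` N) (cst C%:E) x)%E).
  apply: le_integral => //.
  - exact: integrableS intY.
  - exact: finite_measure_integrable_cst.
  - move=> x /[!inE] -[_ Nx]; rewrite lee_fin leNgt; apply/negP => YxC.
    by apply/Nx/NY => /=; apply/negP; rewrite -ltNge.
by rewrite integral_cst// lee_wpmul2l// le_measure ?inE.
Qed.

(** * Expectation of a product of predictable mixtures *)

Section product_of_mixtures.
Context d (T : measurableType d) (R : realType) (P : probability T R).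
Variable gens : nat -> set (set T).
Hypothesis gensT : forall n, <<s gens n >> `<=` measurable.
Hypothesis gensS : forall n, <<s gens n >> `<=` <<s gens n.+1 >>.
Variables (p Z : nat -> nat -> T -> R) (B C : R).
Hypothesis B0 : 0 <= B.
Hypothesis p0 : forall t k x, 0 <= p t k x.
Hypothesis p1 : forall t x, (\sum_(k <oo) (p t k x)%:E = 1)%E.
Hypothesis ZC : forall t k x, 0 <= Z t k x <= C.
Hypothesis mp : forall t k,
  measurable_fun [set: g_sigma_algebraType (gens t)] (p t k).
Hypothesis mZ : forall t k,
  measurable_fun [set: g_sigma_algebraType (gens t.+1)] (Z t k).
Hypothesis ZB : forall t k A, <<s gens t >> A ->
  (\int[P]_(x in A) (Z t k x)%:E <= B%:E * P A)%E.

Definition mixture t x : \bar R := (\sum_(k <oo) (p t k x * Z t k x)%:E)%E.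

Let Z0 t k x : 0 <= Z t k x. Proof. by have /andP[] := ZC t k x. Qed.

Lemma measurable_fun_gensS n d' (U : measurableType d') (f : T -> U) :
  measurable_fun [set: g_sigma_algebraType (gens n)] f ->
  measurable_fun [set: g_sigma_algebraType (gens n.+1)] f.
Proof.
by move=> mf _ Y mY; apply: gensS; have := mf measurableT Y mY.
Qed.

Lemma mixture_ge0 t x : (0 <= mixture t x)%E.
Proof. by apply: nneseries_ge0 => k _ _; rewrite lee_fin mulr_ge0. Qed.

Lemma mixture_fin_num t x : mixture t x \is a fin_num.
Proof.
rewrite ge0_fin_numE ?mixture_ge0//; apply: (@le_lt_trans _ _ C%:E); last by rewrite ltry.
rewrite -[leRHS]mule1 -(p1 t x) -nneseriesZl; last by move=> k _; rewrite lee_fin.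
apply: lee_nneseries => k _; first by rewrite lee_fin mulr_ge0.
by rewrite -EFinM lee_fin mulrC ler_wpM2r//; have /andP[] := ZC t k x.
Qed.

Lemma measurable_mixture t :
  measurable_fun [set: g_sigma_algebraType (gens t.+1)] (mixture t).
Proof.
apply: ge0_emeasurable_sum => [k x _ _|k _]; first by rewrite lee_fin mulr_ge0.
apply/measurable_EFinP; apply: measurable_funM => //.
exact: measurable_fun_gensS.
Qed.

(** Real-valued through [fine], which loses nothing because [ZC] keeps every mixture finite. *)
Definition mixprod n x : R := \prod_(t < n) fine (mixture t x).

Lemma mixprod_ge0 n x : 0 <= mixprod n x.
Proof. by apply: prodr_ge0 => t _; rewrite fine_ge0// mixture_ge0. Qed.

Lemma mixprodS n x : mixprod n.+1 x = mixprod n x * fine (mixture n x).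
Proof. exact: big_ord_recr. Qed.

Lemma measurable_mixprod n :
  measurable_fun [set: g_sigma_algebraType (gens n)] (mixprod n).
Proof.
elim: n => [|n ih].
  by rewrite (_ : mixprod 0 = cst 1)//; apply/funext => x; rewrite /mixprod big_ord0.
rewrite (_ : mixprod n.+1 = fun x => mixprod n x * fine (mixture n x)); last first.
  by apply/funext => x; exact: mixprodS.
apply: measurable_funM; first exact: measurable_fun_gensS.
by apply: measurableT_comp => //; exact: measurable_mixture.
Qed.

(** Induction on [n]: the first [n] factors and the weight [p n k] are known at stage [n], so
    replacing [Z n k] costs a factor [B] in each term of the series, and the weights then sum to
    one. *)
Lemma integral_mixprod_le n : (\int[P]_x (mixprod n x)%:E <= (B ^+ n)%:E)%E.
Proof.
elim: n => [|n ih].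
  under eq_integral do rewrite /mixprod big_ord0.
  by rewrite (integral_cst P measurableT 1%E) mul1e expr0 [leLHS]probability_setT.
have mM := @measurable_mixprod n.
have M0 := mixprod_ge0 n.
have mMp k : measurable_fun [set: g_sigma_algebraType (gens n)]
    (fun x => (mixprod n x * p n k x)%:E).
  by apply/measurable_EFinP; exact: measurable_funM.
have mZT k : measurable_fun [set: T] (Z n k).
  by apply: (measurable_fun_sub (@gensT n.+1)); exact: mZ.
have Mp0 k x : (0 <= (mixprod n x * p n k x)%:E)%E by rewrite lee_fin mulr_ge0.
have mMpT k : measurable_fun [set: T] (fun x => (mixprod n x * p n k x)%:E).
  by apply: (measurable_fun_sub (@gensT n)); exact: mMp.
under eq_integral => x _.
  rewrite mixprodS EFinM fineK ?mixture_fin_num// -nneseriesZl; last first.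
    by move=> k _; rewrite lee_fin mulr_ge0.
  under eq_eseriesr do rewrite -EFinM mulrA EFinM.
  over.
rewrite integral_nneseries//; last 2 first.
- by move=> k; apply: emeasurable_funM => //; exact/measurable_EFinP.
- by move=> k x _; rewrite mule_ge0// lee_fin.
apply: (@le_trans _ _
    (\sum_(k <oo) (B%:E * \int[P]_x (mixprod n x * p n k x)%:E))%E).
  apply: lee_nneseries => [k _ _|k _].
    by apply: integral_ge0 => x _; rewrite mule_ge0// lee_fin.
  by apply: (integral_mul_le_sub (@gensT n) B0) => // A; exact: ZB.
rewrite nneseriesZl; last by move=> k _; exact: integral_ge0.
rewrite -integral_nneseries//.
under eq_integral => x _.
  under eq_eseriesr do rewrite EFinM.
  rewrite nneseriesZl; last by move=> k _; rewrite lee_fin.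
  rewrite p1 mule1.
  over.
by rewrite exprS EFinM lee_wpmul2l.
Qed.

End product_of_mixtures.

(** * Generated sigma-algebras and the cumulant bound in integrated form *)

Section sigma_gen.
Context (R : realType) d (T : measurableType d).
Implicit Types S : set (T -> R).

(** The generators inside [sigma_gen], named so that measurability for the past can be phrased with
    [g_sigma_algebraType]. *)
Definition preimages S : set (set T) :=
  [set A | exists2 X, S X & exists2 B : set R, measurable B & A = X @^-1` B].

Lemma sigma_gen_measurable S :
  (forall X, S X -> measurable_fun setT X) -> <<s preimages S >> `<=` measurable.
Proof.
move=> mS; apply: smallest_sub; first exact: sigma_algebra_measurable.
move=> _ [X SX [B mB ->]].
by rewrite -[X in measurable X]setTI; apply: mS.
Qed.

Lemma sigma_gen_subset S S' : S `<=` S' -> <<s preimages S >> `<=` <<s preimages S' >>.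
Proof.
move=> SS'; apply: sub_sigma_algebra2 => _ [X SX [B mB ->]].
by exists X; [exact: SS'|exists B].
Qed.

Lemma measurable_fun_sigma_gen S X :
  S X -> measurable_fun [set: g_sigma_algebraType (preimages S)] X.
Proof.
move=> SX _ B mB; rewrite setTI; apply: sub_sigma_algebra.
by exists X => //; exists B.
Qed.

Lemma G_meas_measurable_fun (gens : set (set T)) (Y : T -> R) :
  G_meas <<s gens >> Y -> measurable_fun [set: g_sigma_algebraType gens] Y.
Proof. by move=> mY _ B mB; rewrite setTI; exact: mY. Qed.

End sigma_gen.

Section cumulant_bound.
Context d (T : measurableType d) (R : realType) (P : probability T R).
Variable gens : set (set T).
Hypothesis gensT : <<s gens >> `<=` measurable.

Lemma ae_cst_le (a b : R) : {ae P, forall w : T, a <= b} -> a <= b.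
Proof.
move=> [N [mN PN Nab]]; rewrite leNgt; apply/negP => ba.
suff NT : N = setT.
  by move: PN; rewrite NT [LHS]probability_setT => /eqP; rewrite onee_eq0.
rewrite -subTset => w _; apply: Nab => /=.
by apply/negP; rewrite -ltNge.
Qed.

(** For [X = 0] the constant 1 is a version and its logarithm is 0. Applied to the comparator's
    excess over itself, this gives [epsilon >= 0]. *)
Lemma cumulant_bound_ge0 (X : T -> R) (eta e : R) : (forall w, X w = 0) ->
  (forall Y, cond_exp_version P <<s gens >> (fun w => expR (- eta * X w)) Y ->
    {ae P, forall w, ln (Y w) / eta <= e}) -> 0 <= e.
Proof.
move=> X0 YB; apply: ae_cst_le.
have XE : (fun w => expR (- eta * X w)) = cst 1.
  by apply/funext => w; rewrite X0 mulr0 expR0.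
suff /YB : cond_exp_version P <<s gens >> (fun w => expR (- eta * X w)) (cst 1).
  by apply: filterS => w; rewrite ln1 mul0r.
rewrite XE; split => //.
- move=> B mB; have := @measurable_cst _ _ (g_sigma_algebraType gens) _ setT (1 : R).
  by move=> /(_ measurableT B mB); rewrite setTI.
- exact: finite_measure_integrable_cst.
- exact: finite_measure_integrable_cst.
Qed.

Lemma cumulant_bound_integral (X : T -> R) (eta e : R) : 0 < eta ->
  measurable_fun setT X -> (forall w, -1 <= X w <= 1) ->
  (forall Y, cond_exp_version P <<s gens >> (fun w => expR (- eta * X w)) Y ->
    {ae P, forall w, ln (Y w) / eta <= e}) ->
  forall A, <<s gens >> A ->
  (\int[P]_(w in A) (expR (- eta * X w))%:E <= (expR (eta * e))%:E * P A)%E.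
Proof.
move=> eta0 mX X1 YB; apply: (@cond_exp_le_integral _ _ _ _ _ _ (expR eta)) => //.
- by apply: measurableT_comp => //; exact: measurable_funM.
- move=> w; rewrite expR_ge0 ler_expR/=.
  by have /andP[Xl _] := X1 w; have := ler_wpM2l (ltW eta0) Xl; lra.
move=> Y /YB; apply: filterS => w; rewrite ler_pdivrMr// mulrC => lnY.
(* [expR] inverts [ln] only at positive arguments; a nonpositive [Y w] lies below the bound
   anyway. *)
have [Y0|Y0] := leP (Y w) 0; first exact: le_trans (expR_ge0 _).
by rewrite -(@lnK _ (Y w)) ?posrE// ler_expR.
Qed.

End cumulant_bound.

(** * Deterministic consequences of the second-order guarantee *)

Section second_order.
Variable R : realType.
Implicit Types (a g c e K V : R).

Lemma sqrtM_le_weighted a V K : 0 < a -> 0 <= V -> 0 <= K ->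
  2 * Num.sqrt (V * K) <= a * V + K / a.
Proof.
move=> a0 V0 K0; set s := Num.sqrt _.
have s0 : 0 <= s by exact: sqrtr_ge0.
have sE : s ^+ 2 = V * K by rewrite sqr_sqrtr// mulr_ge0.
have m0 : 0 <= a * V + K / a by rewrite addr_ge0 ?mulr_ge0 ?invr_ge0// ltW.
rewrite -(@ler_pXn2r _ 2) ?nnegrE// ?mulr_ge0// exprMn sE.
have : 0 <= (a * V - K / a) ^+ 2 by exact: sqr_ge0.
have -> : (a * V - K / a) ^+ 2 = (a * V + K / a) ^+ 2 - 4 * (V * K).
  by field; rewrite gt_eqF.
rewrite (_ : 2 ^+ 2 = 4 :> R); last by ring.
by lra.
Qed.

Section rounds.
Variables (n : nat) (r : nat -> R) (K : R).
Hypothesis K0 : 0 < K.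
Hypothesis r1 : forall t, -1 <= r t <= 1.
Let S := \sum_(t < n) r t.
Let V := \sum_(t < n) (r t) ^+ 2.
Hypothesis SVK : S <= Num.sqrt (V * K) + K.

Let V0 : 0 <= V. Proof. by apply: sumr_ge0 => t _; exact: sqr_ge0. Qed.

(** Double the guarantee and apply AM-GM with weight [a] to [2 * Num.sqrt (V * K)]; one copy of [S]
    then moves to the right and pairs with [a * V]. *)
Lemma second_order_regret a : 0 < a ->
  S <= K / a + 2 * K + \sum_(t < n) (a * r t ^+ 2 - r t).
Proof.
move=> a0; have := sqrtM_le_weighted a0 V0 (ltW K0); move: SVK.
have -> : \sum_(t < n) (a * r t ^+ 2 - r t) = a * V - S.
  by rewrite /V /S mulr_sumr sumrB.
by lra.
Qed.

(** If [g <= e], AM-GM with weight [g] and [V <= n] suffice, [c <= 1 / 2] making [K / (c * g)] large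
    enough. If [1 <= e], already [S <= n]. *)
Lemma second_order_regret_trivial g e c : 0 < g -> 0 < c -> c <= 1 / 2 ->
  g <= e \/ 1 <= e -> S <= K / (c * g) + n%:R * e * (1 + c * g ^+ 2) + 2 * K.
Proof.
move=> g0 c0 c2 ge.
have e0 : 0 <= e by case: ge => ?; lra.
have Kcg : K / g / 2 <= K / (c * g).
  rewrite -mulrA ler_wpM2l ?(ltW K0)// -invfM lef_pV2 ?posrE ?mulr_gt0//.
  by rewrite mulrC ler_wpM2l ?(ltW g0)//; lra.
have Kcg0 : 0 <= K / (c * g) by rewrite divr_ge0 ?mulr_ge0// ltW.
have n0 : 0 <= n%:R :> R by [].
have en : n%:R * e <= n%:R * e * (1 + c * g ^+ 2).
  by rewrite ler_peMr ?mulr_ge0// lerDl mulr_ge0 ?sqr_ge0// ltW.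
case: ge => [ge|e1].
- have Vn : V <= n%:R.
    rewrite -[n in leRHS]card_ord -sumr_const; apply: ler_sum => t _.
    have /andP[rl ru] := r1 t; rewrite -subr_ge0.
    have -> : 1 - r t ^+ 2 = (1 - r t) * (1 + r t) by ring.
    by rewrite mulr_ge0//; lra.
  have := sqrtM_le_weighted g0 V0 (ltW K0); move: SVK.
  have := ler_wpM2l n0 ge; have := ler_wpM2l (ltW g0) Vn.
  by have := mulr_ge0 (ltW g0) V0; have := K0; lra.
- have Sn : S <= n%:R.
    rewrite -[n in leRHS]card_ord -sumr_const; apply: ler_sum => t _.
    by have /andP[] := r1 t.
  by have := ler_wpM2l n0 e1; have := K0; lra.
Qed.

End rounds.
End second_order.

(** * From mixture domination to the exponential stochastic inequality *)

Section esi_of_mixture.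
Context d (T : measurableType d) (R : realType) (P : probability T R).
Variables (g e : R).
Let c : R := 1 / (1 + Num.sqrt (1 + 4 * g ^+ 2)).
(** The function [phi] of the outline, with [a = c * g]. *)
Definition excess_exp (x : R) : R := expR (g * (c * g * x ^+ 2 - x)).
Hypotheses (g0 : 0 < g) (e0 : 0 <= e).

Lemma excess_exp_bounds x : -1 <= x <= 1 ->
  0 <= excess_exp x <= expR (g * (c * g + 1)).
Proof.
have [c0 _ _ _] := sqrt_ratio_props g0; rewrite -/c in c0.
move=> /andP[x1 x2]; rewrite expR_ge0 ler_expR ler_wpM2l ?(ltW g0)//= lerD//; last lra.
rewrite ler_piMr ?mulr_ge0 ?(ltW c0) ?(ltW g0)//.
have : 0 <= (1 - x) * (1 + x) by rewrite mulr_ge0//; lra.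
by lra.
Qed.

Lemma measurable_excess_exp d' (U : measurableType d') (f : U -> R) :
  measurable_fun setT f -> measurable_fun setT (fun w => excess_exp (f w)).
Proof.
rewrite /excess_exp => mf; apply: measurableT_comp => //.
apply: measurable_funM => //.
apply: measurable_funB => //; apply: measurable_funM => //.
exact: measurable_funX.
Qed.

Lemma integral_excess_exp_le (x : T -> R) (A : set T) : e <= g -> e <= 1 ->
  measurable A -> measurable_fun setT x -> (forall w, -1 <= x w <= 1) ->
  (\int[P]_(w in A) (expR (- (2 * g) * x w))%:E
     <= (expR (2 * g * e))%:E * P A)%E ->
  (\int[P]_(w in A) (excess_exp (x w))%:E
     <= (expR (g * e * (1 + c * g ^+ 2)))%:E * P A)%E.
Proof.
move=> eg e1 mA mx x1 xA.
have [a [b [a0 b0 abB xab]]] := expR_excess_majorant g0 e0 eg e1.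
have mexp : measurable_fun A (fun w => (expR (- (2 * g) * x w))%:E).
  apply/measurable_EFinP; apply: measurable_funTS.
  by apply: measurableT_comp => //; exact: measurable_funM.
apply: (@le_trans _ _
    (\int[P]_(w in A) (a%:E + b%:E * (expR (- (2 * g) * x w))%:E))%E).
  apply: ge0_le_integral => //.
  - by move=> w _; rewrite lee_fin expR_ge0.
  - apply/measurable_EFinP; apply: measurable_funTS.
    exact: measurable_excess_exp.
  - by apply: emeasurable_funD => //; exact: emeasurable_funM.
  - by move=> w _; rewrite -EFinM -EFinD lee_fin; exact: xab.
rewrite ge0_integralD//; last 2 first.
- by move=> w _; rewrite mule_ge0// lee_fin expR_ge0.
- exact: emeasurable_funM.
rewrite integral_cst// ge0_integralZl//.
apply: (@le_trans _ _ ((a + b * expR (2 * g * e))%:E * P A)%E).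
  rewrite EFinD EFinM ge0_muleDl ?lee_fin ?mulr_ge0 ?expR_ge0//.
  by rewrite leeD2l// -muleA lee_wpmul2l.
by rewrite lee_wpmul2r// lee_fin.
Qed.

Variables (S : nat -> set (T -> R)) (p x : nat -> nat -> T -> R).
Hypothesis mS : forall t X, S t X -> measurable_fun setT X.
Hypothesis SS : forall t, S t `<=` S t.+1.
Hypothesis p0 : forall t k w, 0 <= p t k w.
Hypothesis p1 : forall t w, (\sum_(k <oo) (p t k w)%:E = 1)%E.
Hypothesis mp : forall t k,
  measurable_fun [set: g_sigma_algebraType (preimages (S t))] (p t k).
Hypothesis x1 : forall t k w, -1 <= x t k w <= 1.
Hypothesis mx : forall t k,
  measurable_fun [set: g_sigma_algebraType (preimages (S t.+1))] (x t k).
Hypothesis xe : forall t k A, <<s preimages (S t) >> A ->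
  (\int[P]_(w in A) (expR (- (2 * g) * x t k w))%:E
     <= (expR (2 * g * e))%:E * P A)%E.

Let mix := mixture p (fun t k w => excess_exp (x t k w)).

(** The reduction shared by both settings: [Rg] may lie below the linearised regret, and [kappa] is
    the approximation error per round, zero for Hedge and arbitrarily small for OCO. *)
Lemma esi_of_mixture (n : nat) (r : nat -> T -> R) (Rg : T -> R) (K kappa : R) :
  0 < K -> 0 <= kappa -> (forall t w, -1 <= r t w <= 1) ->
  (forall w, Rg w <= \sum_(t < n) r t w) ->
  (forall w, \sum_(t < n) r t w
     <= Num.sqrt ((\sum_(t < n) r t w ^+ 2) * K) + K) ->
  (forall t w, excess_exp (r t w) <= expR kappa * fine (mix t w)) ->
  (\int[P]_w (expR (g * (Rg w -
     (K / (c * g) + n%:R * e * (1 + c * g ^+ 2) + 2 * K))))%:E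
     <= (expR (kappa *+ n))%:E)%E.
Proof.
move=> K0 kappa0 r1 Rgr rVK rmix.
have [c0 cg cg2 c2] := sqrt_ratio_props g0; rewrite -/c in c0 cg cg2 c2.
(* For [e] at least [g] or 1 the exponent is nonpositive at every [w]; otherwise the tangent
   majorant is available. *)
have [ge|ge] := pselect (g <= e \/ 1 <= e).
  apply: (@le_trans _ _ (\int[P]_w (cst 1%E) w)%E).
    apply: ge0_le_integralT => w; first by rewrite lee_fin expR_ge0.
    rewrite lee_fin expR_le1 pmulr_rle0// subr_le0 (le_trans (Rgr w))//.
    exact: (second_order_regret_trivial K0 (r1 ^~ w)).
  rewrite integral_cst// mul1e [leLHS]probability_setT lee_fin -expR0 ler_expR.
  exact: mulrn_wge0.
have [eg e1] : e <= g /\ e <= 1.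
  by split; rewrite leNgt; apply/negP => /ltW h; apply: ge; [left|right].
pose B := expR (g * e * (1 + c * g ^+ 2)).
have B0 : 0 < B by exact: expR_gt0.
have gensT t : <<s preimages (S t) >> `<=` measurable.
  exact/sigma_gen_measurable/mS.
have MB : (\int[P]_w (mixprod p (fun t k w => excess_exp (x t k w)) n w)%:E
    <= (B ^+ n)%:E)%E.
  apply: (@integral_mixprod_le _ _ _ _ (fun t => preimages (S t)) gensT _ _ _ _
    (expR (g * (c * g + 1))) (ltW B0)) => //.
  - by move=> t; exact: sigma_gen_subset.
  - by move=> t k w; exact: excess_exp_bounds.
  - by move=> t k; exact: measurable_excess_exp.
  - move=> t k A SA; apply: integral_excess_exp_le => //.
    + exact: (@gensT t).
    + by apply: (measurable_fun_sub (@gensT t.+1)); exact: mx.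
    + exact: xe.
(* Pointwise domination: [B ^+ n] is the exponential of [g] times the [e] term of the bound, and
   [second_order_regret] with [a = c * g] accounts for the [K] terms. *)
apply: (@le_trans _ _ (\int[P]_w ((expR (kappa *+ n) / B ^+ n)%:E *
    (mixprod p (fun t k w => excess_exp (x t k w)) n w)%:E))%E).
  apply: ge0_le_integralT => w; first by rewrite lee_fin expR_ge0.
  rewrite -EFinM lee_fin [leRHS]mulrAC ler_pdivlMr ?exprn_gt0//.
  rewrite -expRM_natl -expRD.
  have -> : expR (kappa *+ n) * mixprod p (fun t k w => excess_exp (x t k w)) n w =
      \prod_(t < n) (expR kappa * fine (mix t w)).
    by rewrite big_split/= prodr_const card_ord -expRM_natl mulr_natl.
  apply: (@le_trans _ _ (\prod_(t < n) excess_exp (r t w))); last first.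
    by apply: ler_prod => t _; rewrite expR_ge0 rmix.
  rewrite /excess_exp -expR_sum ler_expR -mulr_sumr.
  have cg0 : 0 < c * g by rewrite mulr_gt0.
  have := @second_order_regret _ n (r ^~ w) K K0 (rVK w) _ cg0.
  move=> /(le_trans (Rgr w)) /(ler_wpM2l (ltW g0)); lra.
rewrite ge0_integralZl//; last 3 first.
- apply/measurable_EFinP; apply: (measurable_fun_sub (@gensT n)).
  apply: (@measurable_mixprod _ _ _ (fun t => preimages (S t)) _ _ _
    (expR (g * (c * g + 1)))) => //.
  + by move=> t; exact: sigma_gen_subset.
  + by move=> t k w; exact: excess_exp_bounds.
  + by move=> t k; exact: measurable_excess_exp.
- move=> w _; rewrite lee_fin.
  apply: (@mixprod_ge0 _ _ _ _ _ (expR (g * (c * g + 1)))) => // t k w'.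
  exact: excess_exp_bounds.
- by rewrite lee_fin divr_ge0 ?expR_ge0 ?exprn_ge0// ltW.
apply: (@le_trans _ _ ((expR (kappa *+ n) / B ^+ n)%:E * (B ^+ n)%:E)%E).
  by rewrite lee_wpmul2l// lee_fin divr_ge0 ?expR_ge0 ?exprn_ge0// ltW.
by rewrite -EFinM divfK// gt_eqF// exprn_gt0.
Qed.

End esi_of_mixture.

(** * Hedge: Jensen's inequality for countable mixtures *)

Section hedge.
Variable R : realType.

(** The tangent inequality of the convex [phi]: apply [1 + z <= expR z] to the difference of
    exponents and drop its nonnegative quadratic part. *)
Lemma excess_exp_tangent (g x y : R) : 0 < g ->
  excess_exp g y * (1 + g * (2 * (1 / (1 + Num.sqrt (1 + 4 * g ^+ 2)) * g) * y - 1)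
    * (x - y)) <= excess_exp g x.
Proof.
move=> g0; rewrite /excess_exp; set c : R := 1 / _.
have [c0 _ _ _] := sqrt_ratio_props g0; rewrite -/c in c0.
set a := g * (c * g * y ^+ 2 - y); set b := g * (c * g * x ^+ 2 - x).
rewrite -[b](subrKC a) expRD ler_wpM2l ?expR_ge0//.
apply: le_trans (expR_ge1Dx _); rewrite lerD2l /a /b.
have : 0 <= g * (c * g * (x - y) ^+ 2) 
  by apply: mulr_ge0; [|apply: mulr_ge0; [apply: mulr_ge0|exact: sqr_ge0]]; exact: ltW.
by lra.
Qed.

Lemma pmf_cvg (w : nat -> R) : is_pmf w -> (\sum_(0 <= k < n) w k) @[n --> \oo] --> (1 : R).
Proof.
move=> [w0 w1].
have : (\sum_(0 <= k < n) (w k)%:E @[n --> \oo] --> (1 : R)%:E)%E.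
  rewrite -w1; apply: is_cvg_nneseries => k _ _.
  by rewrite lee_fin.
move=> /fine_cvg; apply: cvg_trans; apply: near_eq_cvg.
by apply: nearW => n /=; rewrite sumEFin.
Qed.

Lemma mixture_jensen (g y : R) (w x : nat -> R) : 0 < g -> is_pmf w ->
  (\sum_(0 <= k < n) w k * x k) @[n --> \oo] --> y ->
  ((excess_exp g y)%:E <= \sum_(k <oo) (w k * excess_exp g (x k))%:E)%E.
Proof.
move=> g0 pmfw wx; have [w0 _] := pmfw.
pose h : R := g * (2 * (1 / (1 + Num.sqrt (1 + 4 * g ^+ 2)) * g) * y - 1).
pose W n : R := \sum_(0 <= k < n) w k.
pose X n : R := \sum_(0 <= k < n) w k * x k.
(* [L n] is the partial sum of the tangents at the mean [y]; weights of mass one and mean [y] make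
   it tend to the value at [y]. *)
pose L n : R := excess_exp g y * (W n + h * (X n - W n * y)).
have Lcvg : L n @[n --> \oo] --> excess_exp g y.
  suff : L n @[n --> \oo] --> excess_exp g y * (1 + h * (y - 1 * y)).
    by rewrite mul1r subrr mulr0 addr0 mulr1.
  apply: cvgM; first exact: cvg_cst.
  apply: cvgD; first exact: pmf_cvg.
  apply: cvgM; first exact: cvg_cst.
  apply: cvgB; first exact: wx.
  apply: cvgM; last exact: cvg_cst.
  exact: pmf_cvg.
have LEcvg : ((L n)%:E @[n --> \oo] --> (excess_exp g y)%:E)%E.
  by apply: cvg_EFin; [exact: nearW|exact: Lcvg].
have /cvg_lim <-// := LEcvg; apply: lime_le.
  by apply/cvg_ex; exists (excess_exp g y)%:E; exact: LEcvg.
apply: nearW => n.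
apply: le_trans (nneseries_lim_ge n _); last first.
  by move=> k _ _; rewrite lee_fin mulr_ge0// expR_ge0.
rewrite sumEFin lee_fin /L /W /X mulr_suml -sumrB mulr_sumr -big_split/= mulr_sumr.
apply: ler_sum => k _.
have := ler_wpM2l (w0 k) (excess_exp_tangent (x k) y g0); rewrite -/h.
by lra.
Qed.

Section inner.
Variables w l : nat -> R.
Hypothesis pmfw : is_pmf w.
Hypothesis l01 : forall k, 0 <= l k <= 1.

Let w0 k : 0 <= w k. Proof. by have [] := pmfw. Qed.

Let sum_le n : \sum_(0 <= k < n) w k * l k <= \sum_(0 <= k < n) w k.
Proof.
by apply: ler_sum => k _; rewrite ler_piMr//; have /andP[] := l01 k.
Qed.

(** [hedge_inner] is a limit, meaningful only under convergence: the partial sums increase and are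
    dominated by those of the weights. *)
Lemma hedge_inner_cvg :
  (\sum_(0 <= k < n) w k * l k) @[n --> \oo] --> hedge_inner w l.
Proof.
apply: nondecreasing_is_cvgn.
  apply/nondecreasing_seqP => n; rewrite big_nat_recr//= lerDl mulr_ge0//.
  by have /andP[] := l01 n.
exists 1 => _ [n _ <-]; apply: le_trans (sum_le n) _.
have <- := cvg_lim (@Rhausdorff R) (pmf_cvg pmfw).
apply: nondecreasing_cvgn_le; last by apply/cvg_ex; exists 1; exact: pmf_cvg.
by apply/nondecreasing_seqP => m; rewrite big_nat_recr//= lerDl.
Qed.

Lemma hedge_inner_ge0_le1 : 0 <= hedge_inner w l <= 1.
Proof.
apply/andP; split.
  apply: (cvgr_to_ge hedge_inner_cvg); apply: nearW => n.
  by apply: sumr_ge0 => k _; rewrite mulr_ge0//; have /andP[] := l01 k.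
apply: (ler_cvg_to hedge_inner_cvg (pmf_cvg pmfw)); apply: nearW => n.
exact: sum_le.
Qed.

Lemma hedge_excess_cvg k0 :
  (\sum_(0 <= k < n) w k * (l k - l k0)) @[n --> \oo] --> hedge_inner w l - l k0.
Proof.
under eq_fun.
  move=> n; under eq_bigr do rewrite mulrBr; rewrite sumrB -mulr_suml; over.
have -> : hedge_inner w l - l k0 = hedge_inner w l - 1 * l k0 by rewrite mul1r.
apply: cvgB; first exact: hedge_inner_cvg.
apply: cvgM; last exact: cvg_cst.
  exact: pmf_cvg.
Qed.

End inner.


Lemma hedge_esi dsp (Omega : measurableType dsp) (P : probability Omega R)
    (A : nat -> (nat -> nat -> R) -> nat -> R) (K : nat -> R) (k0 : nat)
    (l : nat -> Omega -> nat -> R) (e g : R) (n : nat) :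
  let W t w := A t (fun s => l s w) in
  let c : R := 1 / (1 + Num.sqrt (1 + 4 * g ^+ 2)) in
  (forall t L, is_pmf (A t L)) ->
  (forall w, hedge_regret (W ^~ w) (l ^~ w) n k0
     <= Num.sqrt (hedge_var (W ^~ w) (l ^~ w) n k0 * K n) + K n) ->
  0 < K n ->
  (forall t w k, 0 <= l t w k <= 1) ->
  (forall t k, measurable_fun setT (fun w => l t w k)) ->
  (forall t k, (1 <= t)%N -> G_meas (hedge_past l t) (fun w => W t w k)) ->
  (forall t k Y, (1 <= t)%N ->
     cond_exp_version P (hedge_past l t)
       (fun w => expR (- (2 * g) * (l t w k - l t w k0))) Y ->
     {ae P, forall w, ln (Y w) / (2 * g) <= e}) ->
  0 < g ->
  esi P g (fun w => hedge_regret (W ^~ w) (l ^~ w) n k0)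
    (K n / (c * g) + n%:R * e * (1 + c * g ^+ 2) + 2 * K n).
Proof.
move=> W c pmfA regret K0 l01 ml mW ve g0.
(* Rounds start at 1 but mixtures are indexed from 0: [S t] generates the past of round [t.+1], and
   [W'], [x], [r] are shifted alike. *)
pose S t : set (Omega -> R) :=
  [set X | exists s k, (1 <= s < t.+1)%N /\ X = (fun w => l s w k)].
have mS t X : S t X -> measurable_fun setT X by move=> [s [k [_ ->]]].
have gensT t := sigma_gen_measurable (mS t).
have x1 t k w : -1 <= l t w k - l t w k0 <= 1.
  by have := l01 t w k; have := l01 t w k0; lra.
have e0 : 0 <= e.
  apply: (@cumulant_bound_ge0 _ _ _ P (preimages (S 0%N))
    (fun w => l 1%N w k0 - l 1%N w k0) (2 * g)).
    by move=> w; rewrite subrr.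
  by move=> Y; exact: ve.
pose W' t k w := W t.+1 w k.
pose x t k w := l t.+1 w k - l t.+1 w k0.
pose r t w := hedge_inner (W t.+1 w) (l t.+1 w) - l t.+1 w k0.
have W0 t k w : 0 <= W' t k w by have [+ _] := pmfA t.+1 (fun s => l s w); exact.
have W1 t w : (\sum_(k <oo) (W' t k w)%:E = 1)%E.
  by have [_] := pmfA t.+1 (fun s => l s w).
have regE w : hedge_regret (W ^~ w) (l ^~ w) n k0 = \sum_(t < n) r t w.
  by rewrite /hedge_regret big_add1/= big_mkord.
have varE w : hedge_var (W ^~ w) (l ^~ w) n k0 = \sum_(t < n) r t w ^+ 2.
  by rewrite /hedge_var big_add1/= big_mkord.
have mix_fin t w :
    mixture W' (fun t k w => excess_exp g (x t k w)) t w \is a fin_num.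
  apply: (@mixture_fin_num _ _ _ _ _ (expR (g * (c * g + 1)))) => // s k w'.
  by apply: excess_exp_bounds => //; exact: x1.
(* Here [kappa = 0], since Jensen's inequality leaves no approximation error. *)
apply: (@le_trans _ _ (expR (0 *+ n))%:E); last by rewrite mul0rn expR0.
apply: (@esi_of_mixture _ _ _ P _ _ g0 e0 S W' x mS _ _ _ _ _ _ _
  n r _ _ 0 K0) => //.
- move=> t X [s [k [/andP[s1 st] ->]]]; exists s, k; split => //.
  by rewrite s1 ltnS ltnW.
- by move=> t k; apply: G_meas_measurable_fun; exact: mW.
- by move=> t k w; exact: x1.
- move=> t k; apply: measurable_funB; apply: measurable_fun_sigma_gen;
    by eexists _, _; split; last reflexivity; rewrite /= ltnSn.
- move=> t k B SB; apply: (cumulant_bound_integral (gensT t)) => //.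
  + by rewrite mulr_gt0.
  + exact: measurable_funB.
  + by move=> w; exact: x1.
  + by move=> Y; exact: ve.
- move=> t w; have := l01 t.+1 w k0.
  have := hedge_inner_ge0_le1 (pmfA t.+1 (fun s => l s w)) (l01 t.+1 w).
  rewrite /r /W; lra.
- by move=> w; rewrite regE.
- by move=> w; rewrite -regE -varE.
- move=> t w; rewrite expR0 mul1r -lee_fin fineK//.
  apply: (@mixture_jensen _ _ (W t.+1 w)) => //; first exact: pmfA.
  by apply: hedge_excess_cvg => //; exact: pmfA.
Qed.

End hedge.

(** * OCO: inner products, subgradients and finite nets *)

Section dot_product.
Context (R : realType) (d : nat).
Implicit Types u v w : 'rV[R]_d.

Lemma dotvDl u v w : dotv (u + v) w = dotv u w + dotv v w.
Proof.
by rewrite /dotv -big_split; apply: eq_bigr => i _; rewrite mxE mulrDl.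
Qed.

Lemma dotvZl (a : R) u w : dotv (a *: u) w = a * dotv u w.
Proof. by rewrite /dotv mulr_sumr; apply: eq_bigr => i _; rewrite mxE mulrA. Qed.

Lemma dotvNl u w : dotv (- u) w = - dotv u w.
Proof. by rewrite -scaleN1r dotvZl mulN1r. Qed.

Lemma dotvBl u v w : dotv (u - v) w = dotv u w - dotv v w.
Proof. by rewrite dotvDl dotvNl. Qed.

Lemma dotvv_ge0 u : 0 <= dotv u u.
Proof. by apply: sumr_ge0 => i _; rewrite -expr2 sqr_ge0. Qed.

Lemma norm2_ge0 u : 0 <= norm2 u.
Proof. exact: sqrtr_ge0. Qed.

Lemma dotvv_le u (D : R) : norm2 u <= D -> dotv u u <= D ^+ 2.
Proof.
move=> uD; rewrite -[leLHS]sqr_sqrtr ?dotvv_ge0//.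
by rewrite ler_pXn2r ?nnegrE ?sqrtr_ge0//; exact: le_trans (norm2_ge0 u) uD.
Qed.

Lemma norm2_coord u (D : R) i : norm2 u <= D -> `|u ord0 i| <= D.
Proof.
move=> uD; have D0 : 0 <= D by exact: le_trans (norm2_ge0 u) uD.
rewrite -(@ler_pXn2r _ 2) ?nnegrE// real_normK ?num_real//.
apply: le_trans (dotvv_le uD).
by rewrite /dotv (bigD1 i)//= -expr2 lerDl sumr_ge0// => j _; rewrite -expr2 sqr_ge0.
Qed.

(* Weighted AM-GM on [|G u - D v|^2 >= 0] replaces Cauchy-Schwarz. *)
Lemma dotv_le1 u v (D G : R) : D * G = 1 -> norm2 u <= D -> norm2 v <= G ->
  dotv u v <= 1.
Proof.
move=> DG /dotvv_le uD /dotvv_le vG.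
have : 0 <= \sum_(i < d) (G * u ord0 i - D * v ord0 i) ^+ 2.
  by apply: sumr_ge0 => i _; exact: sqr_ge0.
have -> : \sum_(i < d) (G * u ord0 i - D * v ord0 i) ^+ 2 =
    G ^+ 2 * dotv u u + D ^+ 2 * dotv v v - 2 * (D * G) * dotv u v.
  rewrite /dotv !mulr_sumr -big_split -sumrB/=; apply: eq_bigr => i _; ring.
have := ler_wpM2l (sqr_ge0 G) uD; have := ler_wpM2l (sqr_ge0 D) vG.
have : D ^+ 2 * G ^+ 2 = 1 by rewrite -exprMn DG expr1n.
rewrite DG; lra.
Qed.

Lemma dotv_bounds u v (D G : R) : D * G = 1 -> norm2 u <= D -> norm2 v <= G ->
  -1 <= dotv u v <= 1.
Proof.
move=> DG uD vG; rewrite (dotv_le1 DG uD vG) andbT lerNl -dotvNl.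
apply: (dotv_le1 DG) => //.
suff -> : norm2 (- u) = norm2 u by [].
by congr Num.sqrt; apply: eq_bigr => i _; rewrite !mxE mulrNN.
Qed.

Lemma dotv_small u v (a G : R) : (forall i, `|u ord0 i| <= a) -> norm2 v <= G ->
  `|dotv u v| <= d%:R * (a * G).
Proof.
move=> ua vG; apply: le_trans (ler_norm_sum _ _ _) _.
rewrite mulr_natl -[d in leRHS]card_ord -sumr_const; apply: ler_sum => i _.
by rewrite normrM ler_pM// norm2_coord.
Qed.

End dot_product.

Section subgradient.
Context (R : realType) (d : nat) (U : set 'rV[R]_d) (D G : R) (ustar : 'rV[R]_d).
Hypothesis Udiam : forall u v, U u -> U v -> norm2 (u - v) <= D.
Hypothesis DG : D * G = 1.
Hypothesis Uustar : U ustar.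
Variables (F : 'rV[R]_d -> R) (Gr : 'rV[R]_d -> 'rV[R]_d).
Hypothesis adm : oco_admissible U G F Gr.

Lemma excess_bounds u : U u -> -1 <= dotv (u - ustar) (Gr u) <= 1.
Proof.
by move=> Uu; have [_ _ GrG] := adm; apply: (dotv_bounds DG); [exact: Udiam|exact: GrG].
Qed.

Lemma regret_le_linear w : U w -> F w - F ustar <= dotv (w - ustar) (Gr w).
Proof.
move=> Uw; have [_ /(_ w ustar Uw Uustar) + _] := adm.
by rewrite -[w - ustar]opprB dotvNl; lra.
Qed.

(* Subgradients are only assumed to exist, so [Gr] may be discontinuous at [w];
   but approaching [w] along the segment from [ustar] (faster than transversally),
   monotonicity of the subgradients controls the excess loss from above. *)
Lemma excess_le_near_segment w v (m a : R) : U w -> U v -> 0 < m <= 1 ->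
  (forall i, `|(v - (m *: ustar + (1 - m) *: w)) ord0 i| <= m * a) ->
  dotv (v - ustar) (Gr v) <= dotv (w - ustar) (Gr w) + (3 * (d%:R * (a * G)) + m).
Proof.
move=> Uw Uv /andP[m0 m1] va; have [_ sub GrG] := adm.
have Gv := GrG _ Uv; have Gw := GrG _ Uw.
set z := v - (m *: ustar + (1 - m) *: w) in va.
(* The move from [w] to [v] is a step [m] towards [ustar] plus a transversal error [z] of size
   [m * a]. *)
have vE : v - w = z - m *: (w - ustar).
  rewrite /z scalerBr scalerBl scale1r; apply/rowP => i; rewrite !mxE; ring.
have vE' : v - ustar = (w - ustar) + (v - w) by rewrite [RHS]addrC subrKA.
have z1 := dotv_small va Gv; have z2 := dotv_small va Gw.
have s1 := sub _ _ Uw Uv; have s2 := sub _ _ Uv Uw.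
have s3 : dotv (w - v) (Gr v) = - dotv (v - w) (Gr v) by rewrite -dotvNl opprB.
have /andP[b1 b2] : -1 <= dotv (w - ustar) (Gr v) <= 1.
  by apply: (dotv_bounds DG) => //; exact: Udiam.
have zE y : dotv (v - w) y = dotv z y - m * dotv (w - ustar) y.
  by rewrite vE [LHS]dotvBl dotvZl.
rewrite zE in s1; rewrite s3 zE in s2.
rewrite vE' dotvDl zE.
move: z1 z2; rewrite !ler_norml.
rewrite (_ : d%:R * (m * a * G) = m * (d%:R * (a * G))); last by ring.
move: s1 s2 b1 b2.
move: (dotv z (Gr v)) (dotv z (Gr w)) (dotv (w - ustar) (Gr v))
  (dotv (w - ustar) (Gr w)) (d%:R * (a * G)) => zv zw pv pw q.
move=> s1 s2 b1 b2 /andP[zv1 zv2] /andP[zw1 zw2].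
have q0 : 0 <= q by rewrite -(pmulr_rge0 _ m0); lra.
(* The sum of the two subgradient inequalities is divided by [m]; as [z] is of order [m * a], an
   error [2 * q] free of [m] remains. *)
have pvw : pv <= pw + 2 * q.
  rewrite -(ler_pM2l m0); lra.
have : m * q <= q by rewrite ler_piMl.
have : m * (-1) <= m * pv by rewrite ler_wpM2l// ltW.
lra.
Qed.

End subgradient.

(** A finite subcover by sup-norm balls, listed as a sequence padded with [u0] so that it can index
    a mixture over [nat]. *)
Lemma compact_coord_net (R : realType) (d : nat) (U : set 'rV[R]_d)
    (u0 : 'rV[R]_d) (rho : R) : compact U -> U u0 -> 0 < rho ->
  exists2 s : nat -> 'rV[R]_d, (forall k, U (s k)) &
    forall u, U u -> exists k, forall i, `|s k ord0 i - u ord0 i| < rho.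
Proof.
rewrite compact_cover => cptU Uu0 rho0.
have [||N NU UN] := cptU _ U (fun v => (ball v rho)°).
- by move=> v _; exact: open_interior.
- by move=> u Uu; exists u => //; exact: nbhsx_ballx.
exists (fun k => nth u0 (finmap.enum_fset N) k).
  move=> k; have [kN|kN] := ltnP k (size (finmap.enum_fset N)); last by rewrite nth_default.
  by apply/set_mem/NU; exact: mem_nth.
move=> u /UN[v /= vN /interior_subset [_ vu]].
exists (index v (finmap.enum_fset N)) => i.
by rewrite nth_index//; exact: vu.
Qed.

Section indicator_partition.
Context (R : realType) d (T : measurableType d).

(** Countable additivity of the Dirac measure at [w] over the disjointified cover. *)
Lemma sum_indic_seqDU (B : nat -> set T) (w : T) : (forall k, measurable (B k)) ->
  \bigcup_k B k = setT -> (\sum_(k <oo) (\1_(seqDU B k) w : R)%:E = 1)%E.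
Proof.
move=> mB BT.
have mD k : measurable (seqDU B k).
  apply: measurableD => //; exact: bigsetU_measurable.
have UD : \bigcup_k seqDU B k = setT by rewrite -seqDU_bigcup_eq.
have := measure_semi_bigcup (\d_w : {measure set T -> \bar R}) mD (@trivIset_seqDU _ B).
rewrite UD => /(_ measurableT) <-.
by rewrite /= /dirac indicT.
Qed.

End indicator_partition.

(** With [a = c * g <= 1 / 2], the map [x |-> a * x^2 - x] decreases up to 1, so [r] may be replaced
    by [x - e]; restoring [x] then costs at most [3 * e] in the exponent. *)
Lemma excess_exp_shift (R : realType) (g r x e : R) : 0 < g -> 0 < e <= 1 ->
  r <= 1 -> -1 <= x <= 1 -> x <= r + e ->
  excess_exp g r <= expR (3 * g * e) * excess_exp g x.
Proof.
move=> g0 /andP[e0 e1] r1 /andP[x1 x2] xre.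
have [c0 _ cg _] := sqrt_ratio_props g0; rewrite /excess_exp.
set c : R := 1 / _ in c0 cg *.
rewrite -expRD ler_expR.
have -> : 3 * g * e + g * (c * g * x ^+ 2 - x) = g * (3 * e + (c * g * x ^+ 2 - x)) by ring.
rewrite ler_wpM2l ?(ltW g0)//.
have : 0 < c * g by rewrite mulr_gt0.
move: (c * g) cg => a a2 a0.
have h1 : 0 <= (r - (x - e)) * (1 - a * (r + (x - e))).
  rewrite mulr_ge0//; first lra.
  have : a * (r + (x - e)) <= a * 2 by rewrite ler_wpM2l// ?(ltW a0)//; lra.
  by lra.
have h2 : a * (e * (e - 2 * x)) <= 1 / 2 * (e * 3).
  apply: (@le_trans _ _ (a * (e * 3))).
    by rewrite ler_wpM2l ?(ltW a0)// ler_wpM2l ?(ltW e0)//; lra.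
  by rewrite ler_wpM2r// mulr_ge0// ltW.
by lra.
Qed.

(** * OCO: replacing the action by a predictable net point *)

Section oco.
Context (R : realType) dsp (Omega : measurableType dsp) (P : probability Omega R).
Variables (d : nat) (U : set 'rV[R]_d) (D G : R).
Variables (W : nat -> Omega -> 'rV[R]_d) (K : R) (ustar : 'rV[R]_d).
Variables (f : nat -> Omega -> 'rV[R]_d -> R).
Variables (g : nat -> Omega -> 'rV[R]_d -> 'rV[R]_d).
Variables (e gam : R) (n : nat).
Let c : R := 1 / (1 + Num.sqrt (1 + 4 * gam ^+ 2)).
Hypothesis cptU : compact U.
Hypothesis cvxU : convex_vset U.
Hypothesis Udiam : forall u v, U u -> U v -> norm2 (u - v) <= D.
Hypothesis DG : D * G = 1.
Hypothesis UW : forall t w, U (W t w).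
Hypothesis Uustar : U ustar.
Hypothesis regret : forall w, oco_lregret (W ^~ w) (g ^~ w) n ustar
  <= Num.sqrt (oco_var (W ^~ w) (g ^~ w) n ustar * K) + K.
Hypothesis K0 : 0 < K.
Hypothesis adm : forall t w, oco_admissible U G (f t w) (g t w).
Hypothesis mf : forall t u, U u -> measurable_fun setT (fun w => f t w u).
Hypothesis mg : forall t u (i : 'I_d), U u ->
  measurable_fun setT (fun w => g t w u ord0 i).
Hypothesis mW : forall t (i : 'I_d), (1 <= t)%N ->
  G_meas (oco_past U f g t) (fun w => W t w ord0 i).
Hypothesis ve : forall t u Y, (1 <= t)%N -> U u ->
  cond_exp_version P (oco_past U f g t)
    (fun w => expR (- (2 * gam) * dotv (u - ustar) (g t w u))) Y ->
  {ae P, forall w, ln (Y w) / (2 * gam) <= e}.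
Hypothesis gam0 : 0 < gam.

Let S t : set (Omega -> R) :=
  [set X | exists s u, [/\ (1 <= s < t.+1)%N, U u &
     X = (fun w => f s w u) \/ exists i : 'I_d, X = (fun w => g s w u ord0 i)]].

Let mS t X : S t X -> measurable_fun setT X.
Proof. by move=> [s [u [_ Uu [->|[i ->]]]]]; [exact: mf|exact: mg]. Qed.

Let gensT t : <<s preimages (S t) >> `<=` measurable.
Proof. exact: sigma_gen_measurable (@mS t). Qed.

Let G0 : 0 < G.
Proof.
have [_ _ GrG] := adm 0 point.
have G0 : 0 <= G by exact: le_trans (norm2_ge0 _) (GrG _ Uustar).
by rewrite lt_def G0 andbT; apply/eqP => G00; move: DG; rewrite G00 mulr0 => /esym/eqP; rewrite oner_eq0.
Qed.

Let e0 : 0 <= e.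
Proof.
apply: (@cumulant_bound_ge0 _ _ _ P (preimages (S 0%N))
  (fun w => dotv (ustar - ustar) (g 1%N w ustar)) (2 * gam)).
  by move=> w; rewrite subrr -(scale0r 0) dotvZl mul0r.
by move=> Y; exact: ve.
Qed.

Let measurable_dotv t u : U u ->
  measurable_fun [set: g_sigma_algebraType (preimages (S t.+1))]
    (fun w => dotv (u - ustar) (g t.+1 w u)).
Proof.
move=> Uu; apply: measurable_sum => i; apply: measurable_funM => //.
apply: measurable_fun_sigma_gen; exists t.+1, u; split => //.
  by rewrite /= ltnSn.
by right; exists i.
Qed.

Lemma oco_approx_integral (b : R) : 0 < b <= 1 ->
  (\int[P]_w (expR (gam * (oco_regret (W ^~ w) (f ^~ w) n ustar -
     (K / (c * gam) + n%:R * e * (1 + c * gam ^+ 2) + 2 * K))))%:E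
   <= (expR (3 * gam * b *+ n))%:E)%E.
Proof.
move=> b01; have /andP[b0 b1] := b01.
(* The error [3 * (d%:R * (a * G)) + m] is to be at most [b]: each half gets [b / 2], with [d.+1]
   keeping the denominator positive when [d = 0]. *)
pose m := b / 2; pose a := b / (6 * (d.+1%:R * G)).
have dG0 : 0 < d.+1%:R * G by rewrite mulr_gt0.
have a0 : 0 < a by rewrite divr_gt0// mulr_gt0.
have m0 : 0 < m by rewrite divr_gt0.
have m01 : 0 < m <= 1 by rewrite m0/= /m; lra.
have amb : 3 * (d%:R * (a * G)) + m <= b.
  have -> : b = 3 * (d.+1%:R * (a * G)) + m.
    by rewrite /a /m; field; rewrite nat1r pnatr_eq0/= gt_eqF.
  by rewrite lerD2r ler_wpM2l// ler_wpM2r ?ler_nat// mulr_ge0// ltW.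
have [s Us sU] := compact_coord_net cptU Uustar (mulr_gt0 m0 a0).
pose v t w := m *: ustar + (1 - m) *: W t.+1 w.
have Uv t w : U (v t w) by apply: cvxU => //; lra.
(* The event that [s k] is close to [v t w] depends on the past only, as [W t.+1] does. *)
pose B t k := \bigcap_(i in [set: 'I_d])
  [set w | `|s k ord0 i - v t w ord0 i| < m * a].
have mB t k : <<s preimages (S t) >> (B t k).
  apply: (@fin_bigcap_measurable _ (g_sigma_algebraType (preimages (S t)))).
    exact: finite_finset.
  move=> i _.
  have mi : measurable_fun [set: g_sigma_algebraType (preimages (S t))]
      (fun w => `|s k ord0 i - v t w ord0 i|).
    apply: measurableT_comp => //; apply: measurable_funB => //.
    rewrite (_ : (fun w => v t w ord0 i) =
        fun w => m * ustar ord0 i + (1 - m) * W t.+1 w ord0 i); last first.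
      by apply/funext => w; rewrite !mxE.
    apply: measurable_funD => //; apply: measurable_funM => //.
    by apply: G_meas_measurable_fun; exact: mW.
  have := mi measurableT _ (measurable_itv `]-oo, (m * a)[); rewrite setTI.
  by congr (<<s _ >> _); apply/seteqP; split => w /=; rewrite in_itv.
(* The weights select the first close net point; only subgradients at fixed points [s k], which are
   measurable, then enter the mixture. *)
pose p t k w : R := \1_(seqDU (B t) k) w.
pose x t k w := dotv (s k - ustar) (g t.+1 w (s k)).
pose r t w := dotv (W t.+1 w - ustar) (g t.+1 w (W t.+1 w)).
have BT t : \bigcup_k B t k = setT.
  rewrite -subTset => w _; have [k sk] := sU _ (Uv t w).
  by exists k => // i _; exact: sk.
have p1 t w : (\sum_(k <oo) (p t k w)%:E = 1)%E.
  by apply: sum_indic_seqDU => // k; apply: gensT; exact: mB.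
have x1 t k w : -1 <= x t k w <= 1 by exact: (excess_bounds Udiam DG Uustar (adm _ _)).
have r1 t w : -1 <= r t w <= 1 by exact: (excess_bounds Udiam DG Uustar (adm _ _)).
have mix_fin t w :
    mixture p (fun t k w => excess_exp gam (x t k w)) t w \is a fin_num.
  apply: (@mixture_fin_num _ _ _ _ _ (expR (gam * (c * gam + 1)))) => // t' k w'.
  by apply: excess_exp_bounds.
apply: (@esi_of_mixture _ _ _ P _ _ gam0 e0 S p x mS _ _ _ _ _ _ _ n r) => //.
- move=> t X [s' [u [/andP[s1 st] Uu Xfg]]]; exists s', u; split => //.
  by rewrite s1 ltnS ltnW.
- move=> t k; apply: measurable_indic; apply: measurableD; first exact: mB.
  by apply: bigsetU_measurable => j _; exact: mB.
- by move=> t k; exact: measurable_dotv.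
- move=> t k A SA; apply: (cumulant_bound_integral (@gensT t)) => //.
  + by rewrite mulr_gt0.
  + by apply: (measurable_fun_sub (@gensT t.+1)); exact: measurable_dotv.
  + by move=> Y; exact: ve.
- by rewrite !mulr_ge0// ltW.
- move=> w; rewrite /oco_regret big_add1/= big_mkord; apply: ler_sum => t _.
  exact: (regret_le_linear Uustar (adm _ _)).
- by move=> w; have := regret w; rewrite /oco_lregret /oco_var !big_add1/= !big_mkord.
- move=> t w; have : (\bigcup_k seqDU (B t) k) w by rewrite -seqDU_bigcup_eq BT.
  move=> [k _ Dk].
  have Bk : B t k w by move: Dk; rewrite /seqDU => -[].
  (* On cell [k] the mixture reduces to its value at [s k], where the excess loss is at most
     [r t w + b]. *)
  apply: (@le_trans _ _ (expR (3 * gam * b) * excess_exp gam (x t k w))).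
    apply: excess_exp_shift => //; first by have /andP[] := r1 t w.
    apply: le_trans (lerD (lexx _) amb).
    apply: (excess_le_near_segment Udiam DG Uustar (adm _ _)) => // i.
    by have := Bk i I; rewrite /= !mxE => /ltW.
  rewrite ler_wpM2l ?expR_ge0// -lee_fin fineK//.
  apply: le_trans (nneseries_lim_ge k.+1 _); last first.
    by move=> j _ _; rewrite lee_fin mulr_ge0 ?expR_ge0// /p indicE.
  rewrite big_nat_recr//= [X in (_ <= _ + X)%E](_ : _ = (excess_exp gam (x t k w))%:E).
    rewrite leeDr// sume_ge0// => j _; rewrite lee_fin mulr_ge0 ?expR_ge0//.
  by rewrite /p indicE mem_set// mul1r.
Qed.

(** The accuracy [b] is free: it is chosen so that the factor [expR (3 * gam * b *+ n)] is at most
    [1 + z], for arbitrary [z > 0]. *)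
Lemma oco_esi : esi P gam (fun w => oco_regret (W ^~ w) (f ^~ w) n ustar)
  (K / (c * gam) + n%:R * e * (1 + c * gam ^+ 2) + 2 * K).
Proof.
apply/lee_addgt0Pr => z z0.
pose q := 3 * gam * n.+1%:R.
have q0 : 0 < q by rewrite !mulr_gt0.
have l0 : 0 < ln (1 + z) by rewrite ln_gt0// ltrDl.
pose b := Num.min 1 (ln (1 + z) / q).
have b01 : 0 < b <= 1 by rewrite lt_min ltr01 divr_gt0//= ge_min lexx.
apply: le_trans (oco_approx_integral b01) _.
have z1 : 0 < 1 + z by rewrite addr_gt0.
rewrite lee_fin -[leRHS]lnK ?posrE// ler_expR -mulr_natr.
have bq : b * q <= ln (1 + z) by rewrite -ler_pdivlMr// ge_min lexx orbT.
apply: le_trans bq; rewrite /q mulrAC [leRHS]mulrC.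
have /andP[/ltW b0 _] := b01.
by rewrite ler_wpM2r// ler_wpM2l ?ler_nat// mulr_ge0// ltW.
Qed.

End oco.

(** * Assembly of the two settings *)

Unset Implicit Arguments.

Theorem mainTheorem2 (R : realType) :
  (* ===================== Hedge setting ===================== *)
  (forall (dsp : measure_display) (Omega : measurableType dsp)
     (P : probability Omega R)
     (A : nat -> (nat -> nat -> R) -> nat -> R)   (* learner: w_t = A t (past losses) *)
     (K : nat -> R) (kstar : nat)
     (l : nat -> Omega -> nat -> R)               (* random losses l_t^k *)
     (eps gamma : R) (T : nat),
     (* the learner plays a pmf on nat, depending only on l_1, ..., l_{t-1} *)
     (forall t L, is_pmf (A t L)) ->
     (forall t L L', (forall s, (1 <= s < t)%N -> L s = L' s) -> A t L = A t L') ->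
     (* guarantee (G), for every T and every loss sequence *)
     (forall T0 (L : nat -> nat -> R), (forall t k, 0 <= L t k <= 1) ->
        hedge_regret (fun t => A t L) L T0 kstar
          <= Num.sqrt (hedge_var (fun t => A t L) L T0 kstar * K T0) + K T0) ->
     (forall T0, 0 < K T0) ->
     (* random losses in [0,1], measurable *)
     (forall t w k, 0 <= l t w k <= 1) ->
     (forall t k, measurable_fun setT (fun w => l t w k)) ->
     (* w_t is G_{t-1}-measurable *)
     (forall t k, (1 <= t)%N ->
        G_meas (hedge_past l t) (fun w => A t (fun s => l s w) k)) ->
     (* k* minimises the conditional expected loss, for every t *)
     (forall t k Ystar Y, (1 <= t)%N ->
        cond_exp_version P (hedge_past l t) (fun w => l t w kstar) Ystar ->
        cond_exp_version P (hedge_past l t) (fun w => l t w k) Y ->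
        {ae P, forall w, Ystar w <= Y w}) ->
     (* eps = epsilon(2 gamma): the smallest number bounding the normalized
        conditional cumulant generating function of all x_t^k = l_t^k - l_t^{k*} *)
     let valid (eta c : R) :=
       forall t k Y, (1 <= t)%N ->
         cond_exp_version P (hedge_past l t)
           (fun w => expR (- eta * (l t w k - l t w kstar))) Y ->
         {ae P, forall w, ln (Y w) / eta <= c} in
     valid (2 * gamma) eps -> (forall c, valid (2 * gamma) c -> eps <= c) ->
     0 < gamma -> (1 <= T)%N ->
     let c := 1 / (1 + Num.sqrt (1 + 4 * gamma ^+ 2)) in
     esi P gamma
       (fun w => hedge_regret (fun t => A t (fun s => l s w)) (fun s => l s w) T kstar)
       (K T / (c * gamma) + T%:R * eps * (1 + c * gamma ^+ 2) + 2 * K T))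
  /\
  (* ===================== OCO setting ===================== *)
  (forall (dsp : measure_display) (Omega : measurableType dsp)
     (P : probability Omega R)
     (d : nat) (U : set 'rV[R]_d) (D G : R)
     (A : nat -> (nat -> 'rV[R]_d -> R) -> (nat -> 'rV[R]_d -> 'rV[R]_d) -> 'rV[R]_d)
     (K : nat -> R) (ustar : 'rV[R]_d)
     (f : nat -> Omega -> 'rV[R]_d -> R)             (* random loss functions l_t *)
     (g : nat -> Omega -> 'rV[R]_d -> 'rV[R]_d)      (* their chosen subgradients *)
     (eps gamma : R) (T : nat),
     compact U -> convex_vset U ->
     (forall u v, U u -> U v -> norm2 (u - v) <= D) ->
     D * G = 1 ->
     (* the learner plays in U, depending only on l_1, ..., l_{t-1} *)
     (forall t F Gr, U (A t F Gr)) ->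
     (forall t F Gr F' Gr',
        (forall s u, (1 <= s < t)%N -> U u -> F s u = F' s u /\ Gr s u = Gr' s u) ->
        A t F Gr = A t F' Gr') ->
     (* guarantee (G), for every T and every sequence of loss functions *)
     (forall T0 F Gr, (forall t, oco_admissible U G (F t) (Gr t)) ->
        oco_lregret (fun t => A t F Gr) Gr T0 ustar
          <= Num.sqrt (oco_var (fun t => A t F Gr) Gr T0 ustar * K T0) + K T0) ->
     (forall T0, 0 < K T0) ->
     (* random losses: convex, with G-bounded subgradients, measurable *)
     (forall t w, oco_admissible U G (f t w) (g t w)) ->
     (forall t u, U u -> measurable_fun setT (fun w => f t w u)) ->
     (forall t u (i : 'I_d), U u -> measurable_fun setT (fun w => g t w u ord0 i)) ->
     (* w_t is G_{t-1}-measurable *)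
     (forall t (i : 'I_d), (1 <= t)%N ->
        G_meas (oco_past U f g t)
          (fun w => A t (fun s => f s w) (fun s => g s w) ord0 i)) ->
     (* u* minimises the conditional expected loss over U, for every t *)
     U ustar ->
     (forall t u Ystar Y, (1 <= t)%N -> U u ->
        cond_exp_version P (oco_past U f g t) (fun w => f t w ustar) Ystar ->
        cond_exp_version P (oco_past U f g t) (fun w => f t w u) Y ->
        {ae P, forall w, Ystar w <= Y w}) ->
     (* eps = epsilon(2 gamma), for x_t^u = <u - u*, grad l_t(u)> *)
     let valid (eta c : R) :=
       forall t u Y, (1 <= t)%N -> U u ->
         cond_exp_version P (oco_past U f g t)
           (fun w => expR (- eta * dotv (u - ustar) (g t w u))) Y ->
         {ae P, forall w, ln (Y w) / eta <= c} in
     valid (2 * gamma) eps -> (forall c, valid (2 * gamma) c -> eps <= c) ->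
     0 < gamma -> (1 <= T)%N ->
     let c := 1 / (1 + Num.sqrt (1 + 4 * gamma ^+ 2)) in
     esi P gamma
       (fun w => oco_regret (fun t => A t (fun s => f s w) (fun s => g s w))
                   (fun s => f s w) T ustar)
       (K T / (c * gamma) + T%:R * eps * (1 + c * gamma ^+ 2) + 2 * K T)).
Proof.
split.
- move=> dsp Omega P A K kstar l eps gamma T pmfA _ regret K0 l01 ml mA _.
  move=> valid veps _ gamma0 _ c.
  (* Guarantee (G) is used along each realised loss sequence. *)
  have regret' w := regret T _ (l01 ^~ w).
  exact: (@hedge_esi R dsp Omega P A K kstar l eps gamma T pmfA regret' (K0 T)
    l01 ml mA veps gamma0).
- move=> dsp Omega P d U D G A K ustar f g eps gamma T cptU cvxU Udiam DG UA _.
  move=> regret K0 adm mf mg mA Uustar _ valid veps _ gamma0 _ c.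
  have regret' w := regret T _ _ (adm ^~ w).
  exact: (@oco_esi R dsp Omega P d U D G
    (fun t w => A t (fun s => f s w) (fun s => g s w)) (K T) ustar f g eps gamma T
    cptU cvxU Udiam DG (fun t w => UA t _ _) Uustar regret' (K0 T) adm mf mg mA
    veps gamma0).
Qed.
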